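(* Let $K=\mathbf{C}$, let $\mathcal{N}\subset K^{n\times n}$ be the variety of nilpotent $n\times n$ matrices, and let the Borel subgroup $B\subset\mathrm{GL}_n(K)$ of invertible upper-triangular matrices act on $\mathcal{N}$ by conjugation. Then the semi-invariant ring $K[\mathcal{N}]^B_*$ is generated (as a $K$-algebra) by the functions $f^{\mathcal{P}}$, where $\mathcal{P}$ runs through all data as described in the context.
   Context: A function $f\in K[\mathcal{N}]$ is a $B$-semi-invariant of weight $\chi$, for a character $\chi$ of $B$, if $f(gNg^{-1})=\chi(g)f(N)$ for all $g\in B$, $N\in\mathcal{N}$. Write $K[\mathcal{N}]^{B,\chi}$ for the space of these; the semi-invariant ring $K[\mathcal{N}]^B_*=\bigoplus_{\chi}K[\mathcal{N}]^{B,\chi}\subseteq K[\mathcal{N}]$ is the ring of semi-invariants for all characters $\chi$ of $B$. For $a,b\in\{0,\dots,n\}$ and a matrix $M\in K^{n\times n}$, $M_{(a,b)}\in K^{a\times b}$ denotes the submatrix formed by the last $a$ rows and the first $b$ columns of $M$. A datum $\mathcal{P}=((a_i)_i,(a'_j)_j,(\mathcal{P}_{i,j})_{i,j})$ consists of positive integers $s,t$, integers $a_1,\dots,a_s,a'_1,\dots,a'_t\in\{1,\dots,n\}$ with $a_1+\dots+a_s=a'_1+\dots+a'_t=:r$, and polynomials $\mathcal{P}_{i,j}(x)\in K[x]$ for $1\le i\le s$, $1\le j\le t$. For $N\in\mathcal{N}$ let $N^{\mathcal{P}}$ be the $r\times r$ block matrix $\left(\mathcal{P}_{i,j}(N)_{(a_i,a'_j)}\right)_{i,j}$,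 whose $(i,j)$ block is the $a_i\times a'_j$ matrix $\mathcal{P}_{i,j}(N)_{(a_i,a'_j)}$, and set $f^{\mathcal{P}}(N)=\det(N^{\mathcal{P}})$. Each $f^{\mathcal{P}}$ is a $B$-semi-invariant regular function on $\mathcal{N}$ of weight $\sum_{i=1}^s(\omega_{n-a_i+1}+\dots+\omega_n)-\sum_{j=1}^t(\omega_1+\dots+\omega_{a'_j})$, where $\omega_i(g)=g_{i,i}$ (character group written additively). *)

(* Defs.v *)
From mathcomp Require Import all_boot all_order all_algebra.
From mathcomp Require Import boolp classical_sets functions reals complex.
From mathcomp Require Import mpoly.

Set Implicit Arguments.
Unset Strict Implicit.
Unset Printing Implicit Defensive.

Import GRing.Theory.
Local Open Scope ring_scope.
Local Open Scope classical_set_scope.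

Section Definitions.
Variable K : fieldType.

Definition nilcone (n : nat) : set 'M[K]_n :=
  [set N | exists k : nat, N ^+ k = 0].
Arguments nilcone n : clear implicits.

Definition borel (n : nat) : {pred 'M[K]_n} :=
  [pred g | (g \in unitmx) && is_trig_mx g^T].
Arguments borel n : clear implicits.

Lemma nilcone_conj n (g N : 'M[K]_n) :
  g \in borel n -> N \in nilcone n -> g *m N *m invmx g \in nilcone n.
Proof.
move=> /andP[gU _] /set_mem[k Nk]; apply/mem_set; exists k.
suff -> : (g *m N *m invmx g) ^+ k = g *m N ^+ k *m invmx g.
  by rewrite Nk mulmx0 mul0mx.
elim: k {Nk} => [|k IHk]; first by rewrite !expr0 mulmx1 mulmxV.
by rewrite !exprSr IHk -!mulmxE !mulmxA mulmxKV.
Qed.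

Definition borel_act n (g : 'M[K]_n) (gB : g \in borel n) (N : nilcone n) :
    nilcone n :=
  SigSub (nilcone_conj gB (valP N)).

(* K[N]: restrictions to the nilpotent cone of polynomials in the n * n matrix
   entries. *)
Definition regular_fun (n : nat) : set (nilcone n -> K) :=
  [set f | exists p : {mpoly K[n * n]},
    forall N : nilcone n, f N = p.@[mxvec (val N) 0]].

(* Characters are morphisms of algebraic groups B -> K^*; the regular functions
   on B are the p(g) / det(g)^k with p a polynomial in the entries of g.  The
   values of chi outside B are irrelevant. *)
Definition borel_character (n : nat) (chi : 'M[K]_n -> K) : Prop :=
  [/\ {in borel n, forall g, chi g != 0},
      {in borel n &, forall g h, chi (g *m h) = chi g * chi h}
    & exists (p : {mpoly K[n * n]}) (k : nat),
        {in borel n, forall g, chi g = p.@[mxvec g 0] / (\det g) ^+ k}].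

Definition semi_invariant (n : nat) (chi : 'M[K]_n -> K) :
    set (nilcone n -> K) :=
  [set f | regular_fun f /\
    forall (g : 'M[K]_n) (gB : g \in borel n) (N : nilcone n),
      f (borel_act gB N) = chi g * f N].

(* The sum, inside K[N], of the subspaces of semi-invariants over all
   characters. *)
Definition semi_invariant_ring (n : nat) : set (nilcone n -> K) :=
  [set f | exists (m : nat) (chi : 'I_m -> 'M[K]_n -> K)
                  (h : 'I_m -> nilcone n -> K),
    [/\ forall i, borel_character (chi i),
        forall i, semi_invariant (chi i) (h i)
      & f = \sum_(i < m) h i]].

Definition subalgebra (T : Type) (A : set (T -> K)) : Prop :=
  [/\ A 1,
      forall (c : K) (f g : T -> K), A f -> A g -> A (c \*o f + g)
    & forall f g : T -> K, A f -> A g -> A (f * g)].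

Definition generated_subalgebra (T : Type) (S : set (T -> K)) :
    set (T -> K) :=
  smallest (@subalgebra T) S.

(* M_(a,b): the last a rows and the first b columns of M. *)
Definition corner_mx (n : nat) (a b : 'I_n.+1) (M : 'M[K]_n) : 'M[K]_(a, b) :=
  \matrix_(i < a, j < b)
    M (cast_ord (subnK (leq_ord a)) (rshift (n - a) i))
      (widen_ord (leq_ord b) j).

Record datum (n : nat) := Datum {
  nrows : nat;
  ncols : nat;
  nrows_gt0 : (0 < nrows)%N;
  ncols_gt0 : (0 < ncols)%N;
  height : 'I_nrows -> 'I_n.+1;
  width : 'I_ncols -> 'I_n.+1;
  height_gt0 : forall i, (0 < height i)%N;
  width_gt0 : forall j, (0 < width j)%N;
  sum_width : (\sum_j width j = \sum_i height i)%N;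
  entry : 'I_nrows -> 'I_ncols -> {poly K}
}.
Arguments height {n} d i.
Arguments width {n} d j.
Arguments entry {n} d i j.

Definition datum_mx (n : nat) (P : datum n.+1) (N : 'M[K]_n.+1) :
    'M[K]_(\sum_i height P i) :=
  castmx (erefl, sum_width P)
    (\mxblock_(i < nrows P, j < ncols P)
       corner_mx (height P i) (width P j) (horner_mx N (entry P i j))).

Definition datum_fun (n : nat) (P : datum n.+1) (N : nilcone n.+1) : K :=
  \det (datum_mx P (val N)).

End Definitions.

Arguments nilcone K n : clear implicits.
Arguments borel K n : clear implicits.
Arguments regular_fun K n : clear implicits.
Arguments semi_invariant_ring K n : clear implicits.
Arguments datum K n : clear implicits.
Arguments height {K n} d i.
Arguments width {K n} d j.
Arguments entry {K n} d i j.

(* Main.v *)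
Require Import Defs.
From mathcomp Require Import all_boot all_order all_fingroup all_algebra.
From mathcomp Require Import boolp classical_sets functions reals complex mpoly.
(* Imported again so that the names shared with classical_sets denote the
   lemmas on finite sets. *)
From mathcomp Require Import fintype finset.

Set Implicit Arguments.
Unset Strict Implicit.
Unset Printing Implicit Defensive.
Import Order.TTheory GRing.Theory Num.Theory.
Local Open Scope ring_scope.

(** Every determinant attached to a datum is semi-invariant because the last
    [a] rows of [g *m M] and the first [b] columns of [M *m g] only involve the
    last [a] rows, respectively the first [b] columns, of [M] when [g] is upper
    triangular; block by block, conjugation by [g] multiplies the matrix of the
    datum by invertible block diagonal matrices on both sides.

    Conversely let [F] be a semi-invariant, the restriction of a polynomial of
    degree less than [d].  Characters are trivial on the shears [1 + t E_ij],
    i < j, so [F] is invariant under conjugation by shears.  By Cramer's rule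
    the (i, j) entry of [g^-1 N g] is [det g]^-1 times the determinant of [g]
    with its column i replaced by [N] times its column j.  Hence
       Psi_N(g) = (det g)^d F(g^-1 N g)
    is a polynomial in [g], and a linear combination of products of [d]
    determinants whose columns are columns of [g] or [N] times such columns.
    Such a product is the determinant of one block diagonal matrix with [d]
    blocks; more generally, let D = d * size(N) and consider the D x D
    determinants whose column x stacks the vectors b_(x,p)(N) v_x, p < d, for
    polynomials b_(x,p) and vectors v_x ([tensor_det], where the v_x are basis
    vectors).  If the position x carries a column of [g] with index c(x), the
    resulting function of [g] is multilinear before equal columns are
    identified.

    For each nilpotent [N] the invariance of [F] says that [Psi_N] is
    unchanged when a multiple of column i of [g] is added to a later column j:
    [Psi_N] is a highest weight vector for the right action of the general
    linear group on polynomials in [g].  The full polarization of such a vector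
    satisfies the exchange relations of [highest_weight]
    ([polar_highest_weight]), and over a field of characteristic zero these
    force it to be proportional to the result of antisymmetrizing it over the
    columns of a Young tableau ([young_straightening]); the factor depends on
    the weight but not on [N].

    It remains to see what antisymmetrization does to the block determinants.
    Permuting the v_x in a column of the tableau amounts, up to sign, to
    permuting the polynomials b_x there, so the antisymmetrization over the
    vectors is a symmetrization over the polynomials.  By polarization,
    the latter is a combination of determinants in which b_x is the same
    for all x in the column ([alternate_tensor_det]).  When this holds for every
    column of the tableau, and the v_x in a column of length l are the first l
    basis vectors, the block determinant is up to sign the function of a datum
    all of whose heights are the size of the matrix
    ([tensor_det_column_datum]).  Setting [g = 1] expresses [F] through these
    functions ([shear_invariant_span]). *)

(** * Polarization by inclusion and exclusion *)

(** [family (splice C S)] consists of the maps that send [C] into [S] and are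
    the identity elsewhere. *)
Definition splice (X : finType) (C S : {set X}) : X -> {pred X} :=
  fun x y => if x \in C then y \in S else y == x.

Lemma in_splice (X : finType) (C S : {set X}) x y :
  (y \in splice C S x) = if x \in C then y \in S else y == x.
Proof. by []. Qed.

(** If [A] misses an element x of [C], adding or removing x is a sign-reversing
    involution of the interval between [A] and [C]. *)
Lemma alternating_interval_sum (K : numDomainType) (X : finType)
    (A C : {set X}) : A \subset C ->
  \sum_(S : {set X} | (A \subset S) && (S \subset C)) (-1) ^+ #|C :\: S|
    = (A == C)%:R :> K.
Proof.
move=> sAC; have [->|neqAC] := eqVneq A C.
  under eq_bigl do rewrite -eqEsubset eq_sym.
  by rewrite big_pred1_eq setDv cards0.
have /subsetPn[x xC xA] : ~~ (C \subset A).
  by apply: contra neqAC => sCA; rewrite eqEsubset sAC.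
pose toggle (S : {set X}) := if x \in S then S :\ x else x |: S.
have toggleK : involutive toggle.
  move=> S; rewrite /toggle; have [xS|xS] := boolP (x \in S).
    by rewrite setD11 setD1K.
  by rewrite setU11 setU1K.
set s := LHS; suff /eqP : s = - s by rewrite eq_sym eqNr => /eqP.
rewrite {1}/s (reindex_inj (inv_inj toggleK)) /= -sumrN.
have toggleP S : (A \subset toggle S) && (toggle S \subset C)
    = (A \subset S) && (S \subset C).
  rewrite /toggle; case: ifP => xS; last first.
    rewrite subUset sub1set xC /=; congr andb.
    by rewrite -{2}[S](@setU1K _ x) ?xS // subsetD1 xA andbT.
  rewrite subsetD1 xA andbT; congr andb.
  by rewrite -{2}(setD1K xS) subUset sub1set xC.
apply: eq_big => [S|S /andP[_]]; first exact: toggleP.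
have addC1 (T : {set X}) : x \notin T -> T \subset C ->
    (-1) ^+ #|C :\: (x |: T)| = - (-1) ^+ #|C :\: T| :> K.
  move=> xT sTC; rewrite (cardsD1 x (C :\: T)) !inE xT xC exprD mulN1r opprK.
  by congr (_ ^+ #|pred_of_set _|); apply/setP => y; rewrite !inE negb_or andbA.
rewrite /toggle; case: ifP => xS.
  rewrite -{3}(setD1K xS) => sSC; rewrite addC1 ?opprK ?setD11 //.
by rewrite subUset => /andP[_ sSC]; rewrite addC1 ?xS.
Qed.

(** A map occurs on the right once for each [S] between the image of [C] and
    [C]; the signs cancel unless this image is all of [C], that is, unless the
    map is a permutation.  When [h f] is a product over x in [C] of quantities
    linear in a vector indexed by [f x], the inner sum is the same product with
    all these vectors equal to the sum of the vectors indexed by [S], so that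
    this is the polarization identity. *)
Lemma sum_perm_splice (K : numDomainType) (X : finType) (C : {set X})
    (h : (X -> X) -> K) :
  \sum_(s : {perm X} | perm_on C s) h s =
  \sum_(S : {set X} | S \subset C) (-1) ^+ #|C :\: S| *
    \sum_(f in family (splice C S)) h (f : {ffun X -> X}).
Proof.
under [RHS]eq_bigr do rewrite mulr_sumr.
rewrite (exchange_big_dep (fun f : {ffun X -> X} => f \in family (splice C C)))
  /=; last first.
  move=> S f sSC /familyP fS; apply/familyP => x; move: (fS x).
  by rewrite !in_splice; case: ifP => // _; apply: (subsetP sSC).
transitivity (\sum_(f : {ffun X -> X} | f \in family (splice C C))
    (f @: C == C)%:R * h f); last first.
  apply: eq_bigr => f /familyP fC.
  have sfC : f @: C \subset C.
    by apply/subsetP => _ /imsetP[x xC ->]; move: (fC x); rewrite in_splice xC.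
  rewrite -mulr_suml; congr (_ * _).
  rewrite -(alternating_interval_sum K sfC); apply: eq_bigl => S.
  rewrite andbC; apply: andb_id2l => sSC; apply/subsetP/familyP => [fS x|fS y].
    move: (fC x); rewrite !in_splice; case: ifP => // xC _.
    by apply: fS; apply: imset_f.
  by case/imsetP => x xC ->; move: (fS x); rewrite in_splice xC.
rewrite (bigID (fun f : {ffun X -> X} => f @: C == C)) /=.
rewrite [X in _ = _ + X]big1 ?addr0 => [|f /andP[_ /negPf->]]; last first.
  by rewrite mul0r.
rewrite (reindex_onto (fun s : {perm X} => [ffun x => s x])
  (fun f : {ffun X -> X} => insubd (1%g : {perm X}) f)) /=; last first.
  move=> f /andP[/familyP fC /eqP fCC].
  have injf : injective f.
    have injC : {in C &, injective f}.
      by apply/imset_injP; rewrite fCC.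
    have fE x : x \notin C -> f x = x.
      by move=> /negPf xC; move: (fC x); rewrite in_splice xC => /eqP.
    have fCE x : (f x \in C) = (x \in C).
      apply/idP/idP => [|xC]; last by rewrite -fCC imset_f.
      by apply: contraLR => xC; rewrite fE.
    move=> x y fxy; have [xC|xC] := boolP (x \in C).
      by apply: injC => //; rewrite -fCE -fxy fCE.
    by rewrite -[x]fE // fxy fE // -fCE -fxy fCE.
  apply/ffunP => x; rewrite ffunE /insubd; case: insubP => [s _ <-|].
    by rewrite pvalE.
  by case/negP; apply/injectiveP.
have vE (s : {perm X}) : insubd (1%g : {perm X}) [ffun x => s x] = s.
  apply: val_inj; rewrite val_insubd; case: ifP => [_|/negP[]].
    by apply/ffunP => x; rewrite ffunE -pvalE.
  by apply/injectiveP => x y; rewrite !ffunE => /perm_inj.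
apply: eq_big => [s|s sC]; last first.
  suff -> : [ffun x => s x] @: C == C.
    by rewrite mul1r; congr h; apply/funext => x; rewrite ffunE.
  apply/eqP; rewrite -{2}(im_perm_on sC); apply: eq_imset => x.
  by rewrite !ffunE.
rewrite vE eqxx andbT; apply/idP/andP => [sC|[/familyP sC _]].
  split; last first.
    by apply/eqP; rewrite -{2}(im_perm_on sC); apply: eq_imset => x;
      rewrite !ffunE.
  apply/familyP => x; rewrite in_splice ffunE; case: ifP => xC.
    by rewrite perm_closed.
  by rewrite (out_perm sC) ?xC.
apply/subsetP => x; apply: contraR => xC; apply/eqP.
by move: (sC x); rewrite in_splice ffunE (negPf xC) => /eqP.
Qed.

(** * Straightening highest weight tensors *)

(** A word [w] is a multi-index for a tensor with one factor for each position
    in [X], and [m] is the family of coefficients of a tensor.  The colouring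
    [c] divides the positions into the rows of a tableau. *)
Section Young.
Variables (K : numFieldType) (X : finType) (n : nat).
Implicit Types (w : X -> 'I_n) (m : (X -> 'I_n) -> K) (Y C : {set X}).

Lemma perm_on_tperm C x y : x \in C -> y \in C -> perm_on C (tperm x y).
Proof.
move=> xC yC; apply: subset_trans (tperm_on x y) _.
by rewrite subUset !sub1set xC.
Qed.

Definition alternate C m w : K :=
  \sum_(s : {perm X} | perm_on C s) (-1) ^+ s * m (w \o s).

Definition alternates (cols : seq (seq X)) m : (X -> 'I_n) -> K :=
  foldl (fun m col => alternate [set x in col] m) m cols.

Lemma alternates_sum (I : finType) (P : pred I) (a : I -> K)
    (m : I -> (X -> 'I_n) -> K) cols w :
  alternates cols (fun w => \sum_(i | P i) a i * m i w) w =
  \sum_(i | P i) a i * alternates cols (m i) w.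
Proof.
elim: cols m w => [|col cols IH] m w //=.
rewrite -(IH (fun i => alternate [set x in col] (m i))).
congr (alternates _ _ _); apply/funext => u; rewrite /alternate.
under eq_bigr do rewrite mulr_sumr.
rewrite exchange_big; apply: eq_bigr => i _ /=; rewrite mulr_sumr.
by apply: eq_bigr => s _; rewrite mulrCA.
Qed.

Variable c : X -> 'I_n.

(** With the first condition the second one says that symmetrizing [m] over row
    i together with one position x of a later row gives zero.  Both conditions
    only concern the positions in [Y], the part of the tableau still to be
    treated. *)
Definition highest_weight Y m : Prop :=
  (forall w x y, x \in Y -> y \in Y -> c x = c y ->
     m (w \o tperm x y) = m w) /\
  (forall w x (i : 'I_n), x \in Y -> (i < c x)%N ->
     m w + \sum_(y in Y | c y == i) m (w \o tperm x y) = 0).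

(** A first column of the tableau [Y]: it meets every nonempty row once, and
    the nonempty rows are an initial segment. *)
Definition transversal_column C Y : Prop :=
  [/\ C \subset Y, {in C &, injective c} &
      forall y (i : 'I_n), y \in Y -> (i <= c y)%N ->
        exists2 x, x \in C & c x = i].

(** Let a be the element moved by [s] that lies in the highest row, and let
    [s b = a].  In [w \o s] the position b, which lies in a lower row, carries
    the colour of row a.  Exchanging b with a position of row a other than a
    itself changes nothing, since both carry that colour, so the exchange
    relation compares [w \o s] with the word in which a is put back in
    place, up to the factor - 1 / (size of row a).  Since the sign of the
    permutation changes too, every permutation contributes with a positive
    factor. *)
Lemma column_perm_scalar Y C (s : {perm X}) :
  transversal_column C Y -> perm_on C s ->
  exists2 q : K, 0 < q & forall m w, highest_weight Y m -> {in Y, w =1 c} ->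
    (-1) ^+ s * m (w \o s) = q * m w.
Proof.
move=> [sCY injC _].
have [k] := ubnP #|[set x | s x != x]|; elim: k s => // k IHk s.
rewrite ltnS => le_s_k sC.
have [s0|/set0Pn[a0 le_a0]] := eqVneq [set x | s x != x] set0.
  exists 1 => // m w _ _; suff -> : s = 1%g.
    rewrite odd_perm1 expr0 !mul1r; congr m; apply/funext => x /=.
    by rewrite perm1.
  apply/permP => x; rewrite perm1; apply/eqP; apply: contraT => sx.
  by have := in_set0 x; rewrite -s0 inE sx.
case: (arg_minnP (P := mem [set x | s x != x]) (fun x => c x : nat) le_a0).
move=> a /=; rewrite inE => sa a_min.
pose b := (s^-1)%g a; have sb : s b = a by rewrite permKV.
have bPa : b != a by apply: contra sa => /eqP e; rewrite -{1}e sb.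
have bs : b \in [set x | s x != x] by rewrite inE sb eq_sym.
have aC : a \in C by apply: contraR sa => /(out_perm sC)->.
have bC : b \in C by move: bs; rewrite inE; apply: contraR => /(out_perm sC)->.
have aY : a \in Y by exact: (subsetP sCY).
have bY : b \in Y by exact: (subsetP sCY).
have lt_ab : (c a < c b)%N.
  rewrite ltn_neqAle a_min // andbT; apply: contra bPa => /eqP/val_inj e.
  by apply/eqP; apply: injC.
pose t := (tperm b a * s)%g.
have tE x : t x = s (tperm b a x) by rewrite permM.
have tC : perm_on C t by rewrite perm_onM // perm_on_tperm.
have lt_ts : (#|[set x | t x != x]| < #|[set x | s x != x]|)%N.
  apply/proper_card/properP; split; last first.
    by exists a; rewrite inE ?sa // tE tpermR sb eqxx.
  apply/subsetP => x; rewrite inE tE; case: tpermP => [->|->|_ _].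
  - by rewrite bs.
  - by rewrite sb eqxx.
  by rewrite inE.
have [q q0 qP] := IHk t (leq_trans lt_ts le_s_k) tC.
(* 1 + r is the number of positions of [Y] in the row of a. *)
pose r := \sum_(y in Y | (c y == c a) && (y != a)) (1 : K).
have r0 : 0 <= r by apply: sumr_ge0.
exists (q / (1 + r)); first by rewrite divr_gt0 // ltr_wpDr.
move=> m w hw wc; have [_ raise] := hw.
have := raise (w \o s) b (c a) (subsetP sCY b bC) lt_ab.
rewrite (bigD1 a) /=; last by rewrite aY eqxx.
under eq_bigl do rewrite -andbA.
have -> : (w \o s) \o tperm b a = w \o t.
  by apply/funext => x /=; rewrite tE.
have -> : \sum_(y in Y | (c y == c a) && (y != a)) m ((w \o s) \o tperm b y)
    = r * m (w \o s).
  rewrite mulr_suml; apply: eq_bigr => y /and3P[yY /eqP cy ya].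
  rewrite mul1r; congr m; apply/funext => x /=.
  have yC : y \notin C.
    by apply: contra ya => yC; apply/eqP; apply: injC.
  by case: tpermP => // ->; rewrite sb (out_perm sC yC) !wc.
move=> rel.
have -> : (-1) ^+ s * m (w \o s) = (-1) ^+ t * m (w \o t) / (1 + r).
  apply: (canRL (mulfK _)); first by rewrite gt_eqF // ltr_wpDr.
  rewrite odd_mul_tperm bPa /= signrN mulNr -mulrA -mulrN; congr (_ * _).
  by apply/eqP; rewrite -addr_eq0 -rel mulrDr mulr1 [m _ * r]mulrC -!addrA
    [r * _ + _]addrC.
by rewrite qP // mulrAC.
Qed.

(** The factor is a sum of positive terms, hence not zero; it does not depend
    on [m], which is what later makes it uniform in the nilpotent matrix. *)
Lemma alternate_column Y C : transversal_column C Y ->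
  exists2 q : K, q != 0 & forall m w, highest_weight Y m -> {in Y, w =1 c} ->
    alternate C m w = q * m w.
Proof.
move=> colC.
have /choice[q qP] (s : {perm X}) : exists q : K, perm_on C s -> 0 < q /\
    forall m w, highest_weight Y m -> {in Y, w =1 c} ->
      (-1) ^+ s * m (w \o s) = q * m w.
  have [sC|nsC] := boolP (perm_on C s); last by exists 0.
  by have [q q0 qP] := column_perm_scalar colC sC; exists q.
exists (\sum_(s : {perm X} | perm_on C s) q s).
  rewrite gt_eqF // (bigD1 1%g) ?perm_on1 //= ltr_wpDr //.
    by apply: sumr_ge0 => s /andP[/qP[/ltW]].
  by have [] := qP _ (perm_on1 C).
move=> m w hw wc; rewrite mulr_suml; apply: eq_bigr => s /qP[_]; exact.
Qed.

(** Removing the column [C] leaves a tensor of the same kind.  In the exchange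
    relation for a position x and row i, the rows of [Y :\: C] lack the position
    a of [C] in row i; the missing term, alternated over [C], vanishes because
    it is symmetric under exchanging x with the position b of [C] in the row of
    x, which here amounts to exchanging a and b in the alternation. *)
Lemma alternate_highest_weight Y C m : transversal_column C Y ->
  highest_weight Y m -> highest_weight (Y :\: C) (alternate C m).
Proof.
move=> [sCY injC colC] [sym raise].
have commC w (s : {perm X}) x y : perm_on C s ->
    x \in Y :\: C -> y \in Y :\: C ->
    (w \o tperm x y) \o s = (w \o s) \o tperm x y.
  move=> sC /setDP[_ xC] /setDP[_ yC]; apply/funext => z /=; congr w.
  case: (tpermP x y z) => [->|->|xz yz].
  - by rewrite !(out_perm sC) ?tpermL.
  - by rewrite !(out_perm sC) ?tpermR.
  have fixed u : u \notin C -> z <> u -> u != s z.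
    move=> uC zu; apply/eqP => e; apply: zu; apply: (@perm_inj _ s).
    by rewrite (out_perm sC uC).
  by rewrite tpermD ?fixed.
split=> [w x y xY yY cxy|w x i xY lt_ix].
  apply: eq_bigr => s sC; congr (_ * _).
  rewrite commC // sym //; first by case/setDP: xY.
  by case/setDP: yY.
have [xY' xC] := setDP xY.
have [a aC ca] := colC x i xY' (ltnW lt_ix).
have [b bC cb] := colC x (c x) xY' (leqnn _).
have aY : a \in Y by exact: (subsetP sCY).
have abP : a != b by apply: contraTneq lt_ix => ab; rewrite -ca ab cb ltnn.
have xa : x != a by apply: contraNneq xC => ->.
have xb : x != b by apply: contraNneq xC => ->.
rewrite exchange_big -big_split /=.
transitivity (- \sum_(s : {perm X} | perm_on C s)
    (-1) ^+ s * m ((w \o s) \o tperm x a)).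
  rewrite -sumrN; apply: eq_bigr => s sC; rewrite -mulrN -mulr_sumr -mulrDr.
  congr (_ * _); apply/eqP; rewrite -addr_eq0; apply/eqP.
  rewrite -[RHS](raise (w \o s) x i xY' lt_ix).
  rewrite [X in _ = _ + X](bigD1 a) /=; last by rewrite aY ca eqxx.
  rewrite -addrA; congr (_ + _); rewrite addrC; congr (_ + _).
  apply: eq_big => [y|y /andP[yYC _]]; last by rewrite commC.
  rewrite !inE andbAC andbC -andbA; congr andb.
  rewrite andbC; apply: andb_id2l => /eqP cy.
  apply/idP/idP => [|ya]; first by apply: contraNneq => ->.
  by apply: contra ya => yC; apply/eqP; apply: injC; rewrite // ca.
apply/eqP; rewrite oppr_eq0; set S := \sum_(s | _) _.
rewrite -eqNr -sumrN; apply/eqP; symmetry.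
rewrite {1}/S (reindex_inj (mulgI (tperm a b))) /=; apply: eq_big => [s|s sC].
  have tC := perm_on_tperm aC bC.
  apply/idP/idP => [sC|]; last exact: perm_onM.
  by rewrite -[s](mulKg (tperm a b)) tpermV perm_onM.
rewrite odd_mul_tperm abP signrN mulNr; congr (- (_ * _)).
rewrite -(sym ((w \o s) \o tperm x a) x b) //; last exact: (subsetP sCY).
congr m; apply/funext => y /=; congr w; rewrite permM; congr (s _).
have ax : a != x by rewrite eq_sym.
have bx : b != x by rewrite eq_sym.
have ba : b != a by rewrite eq_sym.
case: (tpermP x b y) => [->|->|/eqP yx /eqP yb].
- by rewrite !tpermL tpermD.
- by rewrite [tperm x a b]tpermD // tpermR tpermL.
by case: (tpermP x a y) => [e|_|/eqP yx' /eqP ya];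
  [rewrite e eqxx in yx | rewrite tpermD | rewrite tpermD // eq_sym].
Qed.

(** A column is listed from the top, so that its l-th entry has colour l. *)
Definition is_column (col : seq X) : bool :=
  (0 < size col)%N && ([seq c x : nat | x <- col] == iota 0 (size col)).

(** If some row above a nonempty row is empty there is no column to remove, but
    then the exchange relation has a single term. *)
Lemma initial_column Y : Y != set0 ->
  (exists2 x, x \in Y & exists2 i : 'I_n, (i < c x)%N &
     forall y, y \in Y -> c y != i) \/
  (exists2 col, is_column col & uniq col /\
     transversal_column [set x in col] Y).
Proof.
case/set0Pn => x0 Yx0; case: (arg_maxnP (P := mem Y) (fun x => c x : nat) Yx0).
move=> a /= aY a_max.
have [/existsP[i /andP[lt_ia /forall_inP noi]]|] :=
  boolP [exists i : 'I_n, (i < c a)%N && [forall y in Y, c y != i]].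
  by left; exists a => //; exists i.
rewrite negb_exists => /forallP full; right.
pose f l := odflt a [pick y in Y | c y == l :> nat].
have fP (i : 'I_n) : (i <= c a)%N -> f i \in Y /\ c (f i) = i.
  move=> le_i; rewrite /f; case: pickP => [y /andP[yY /eqP/val_inj cy]|no] //=.
  move: le_i; rewrite leq_eqVlt => /predU1P[e|lt_i].
    by have := no a; rewrite aY e eqxx.
  move: (full i); rewrite lt_i /= => /negP[]; apply/forall_inP => y yY.
  by apply/eqP => e; have := no y; rewrite yY e eqxx.
pose col := [seq f l | l <- iota 0 (c a).+1].
have le_a l : l \in iota 0 (c a).+1 -> (l <= c a)%N by rewrite mem_iota.
have ltn_n l : l \in iota 0 (c a).+1 -> (l < n)%N.
  by rewrite mem_iota ltnS => /= le_l; apply: leq_ltn_trans (ltn_ord (c a)).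
have colE : [seq c x : nat | x <- col] = iota 0 (c a).+1.
  rewrite -map_comp -[RHS]map_id; apply/eq_in_map => l li /=.
  have [|_ /= ->] // := fP (Ordinal (ltn_n l li)).
  exact: le_a.
have colP x : x \in col -> exists2 i : 'I_n, (i <= c a)%N & x = f i.
  case/mapP => l li ->; exists (Ordinal (ltn_n l li)) => //=.
  exact: le_a.
exists col; first by rewrite /is_column colE !size_map size_iota /= eqxx.
split; first by apply: (@map_uniq _ _ (fun x => c x : nat));
  rewrite colE iota_uniq.
split=> [|x y|y i yY le_iy].
- by apply/subsetP => x; rewrite inE => /colP[i /fP[fY _] ->].
- rewrite !inE => /colP[i /fP[_ ci] ->] /colP[j /fP[_ cj] ->].
  by rewrite ci cj => ->.
have le_ia : (i <= c a)%N by apply: leq_trans le_iy (a_max _ yY).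
exists (f i); last by have [] := fP i le_ia.
by rewrite inE; apply/mapP; exists (i : nat); rewrite // mem_iota.
Qed.

(** First columns are removed one after the other.  The first case arises when
    the sizes of the rows do not form a partition.  In the second, the factor
    [a] is the product of the inverses of the factors of [alternate_column]. *)
Lemma young_straightening Y :
  (forall m w, highest_weight Y m -> {in Y, w =1 c} -> m w = 0) \/
  (exists (a : K) (cols : seq (seq X)),
    [/\ all is_column cols, uniq (flatten cols), flatten cols =i Y &
     forall m w, highest_weight Y m -> {in Y, w =1 c} ->
       m w = a * alternates cols m w]).
Proof.
have [k] := ubnP #|Y|; elim: k Y => // k IHk Y; rewrite ltnS => leYk.
have [Y0|nzY] := eqVneq Y set0.
  right; exists 1, [::]; split=> // [x|m w _ _]; last by rewrite mul1r.
  by rewrite Y0 in_set0.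
case: (initial_column nzY) => [[x xY [i lt_ix noi]]|[col is_col [ucol colT]]].
  left=> m w [_ raise] _; rewrite -[RHS](raise w x i xY lt_ix).
  by rewrite big1 ?addr0 // => y /andP[/noi/negPf->].
have [q q0 qP] := alternate_column colT.
have sCY : [set x in col] \subset Y by case: colT.
have ltD : (#|Y :\: [set x in col]| < k)%N.
  apply: leq_trans leYk; apply/proper_card/properP.
  split; first exact: subsetDl.
  case: col is_col {ucol colT q q0 qP} sCY => // x col _ /subsetP sCY.
  by exists x; [apply: sCY | ]; rewrite !inE eqxx.
have sub m w : m w = q^-1 * (q * m w) by rewrite mulKf.
case: (IHk _ ltD) => [zero|[a [cols [colsP ucols colsE aP]]]].
  left=> m w hw wc; rewrite sub -(qP m w hw wc) zero ?mulr0 //.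
    exact: alternate_highest_weight.
  by move=> x /setDP[/wc].
right; exists (q^-1 * a), (col :: cols); split=> /=.
- by rewrite is_col.
- rewrite cat_uniq ucol ucols andbT /=; apply/hasPn => x.
  by rewrite colsE !inE => /andP[].
- move=> x; rewrite mem_cat colsE !inE; case: (boolP (x \in col)) => //= xcol.
  by rewrite (subsetP sCY) // inE.
move=> m w hw wc; rewrite sub -(qP m w hw wc) aP ?mulrA //.
  exact: alternate_highest_weight.
by move=> x /setDP[/wc].
Qed.

End Young.

(** * Polynomials in the columns of a matrix *)

Lemma poly_fun_eq0 (K : numFieldType) (p : {poly K}) :
  (forall t, p.[t] = 0) -> p = 0.
Proof.
move=> p0; apply: contraTeq isT => nzp.
have := @max_poly_roots _ p [seq i%:R | i <- iota 0 (size p)] nzp.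
rewrite size_map size_iota ltnn; apply.
  by apply/allP => t _; apply/eqP.
by rewrite map_inj_uniq ?iota_uniq // => i j /eqP; rewrite eqr_nat => /eqP.
Qed.

Lemma deriv_prod (R : comNzRingType) (I : eqType) (r : seq I)
    (F : I -> {poly R}) : uniq r ->
  (\prod_(i <- r) F i)^`() =
  \sum_(i <- r) (F i)^`() * \prod_(j <- r | j != i) F j.
Proof.
elim: r => [|a r IHr] /=; first by rewrite !big_nil derivC.
case/andP=> ar /IHr E; rewrite !big_cons derivM E eqxx /=; congr (_ * _ + _).
  rewrite big_seq [RHS]big_seq_cond; apply: eq_bigl => i.
  by rewrite andb_idr // => ir; apply: contraNneq ar => <-.
rewrite mulr_sumr; apply: eq_big_seq => i ir.
by rewrite big_cons (memPnC ar) // mulrCA.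
Qed.

(** A polynomial function of a matrix [g], homogeneous of degree [#|X|], is
    written as a combination of monomials indexed by two words: [w x] and [c x]
    are the row and the column of the x-th factor. *)
Section PolarForm.
Variables (K : numFieldType) (X : finType) (n : nat).
Implicit Types (k : (X -> 'I_n) -> (X -> 'I_n) -> K) (g : 'M[K]_n).

Definition word_form k g : K :=
  \sum_(c : {ffun X -> 'I_n}) \sum_(w : {ffun X -> 'I_n})
    k c w * \prod_x g (w x) (c x).

(** The derivative of [word_form k] with respect to all the entries
    [g (w x) (c x)], x in [X]. *)
Definition polar k (c w : X -> 'I_n) : K :=
  \sum_(s : {perm X}) k (c \o s) (w \o s).

Definition recolor (c : X -> 'I_n) (x : X) (j : 'I_n) : X -> 'I_n :=
  fun y => if y == x then j else c y.

(** On the line [g + t], the product of the form with the characteristic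
    polynomial of [- g] vanishes identically. *)
Lemma word_form_eq0 k : (forall g, g \in unitmx -> word_form k g = 0) ->
  forall g, word_form k g = 0.
Proof.
move=> k0 g.
pose P := \sum_(c : {ffun X -> 'I_n}) \sum_(w : {ffun X -> 'I_n})
  (k c w)%:P * \prod_x ((g (w x) (c x))%:P + 'X *+ (w x == c x)).
have PE t : P.[t] = word_form k (g + t%:M).
  rewrite horner_sum; apply: eq_bigr => c _; rewrite horner_sum.
  apply: eq_bigr => w _; rewrite hornerM hornerC horner_prod.
  congr (_ * _); apply: eq_bigr => x _.
  by rewrite !mxE !hornerE hornerMn hornerX.
have QE t : (char_poly (- g)).[t] = \det (g + t%:M).
  rewrite /char_poly -horner_evalE -det_map_mx; congr (\det _).
  by apply/matrixP => a b; rewrite !mxE /= /horner_eval hornerD 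
    hornerN hornerC hornerMn hornerX opprK addrC.
have : P * char_poly (- g) = 0.
  apply: poly_fun_eq0 => u; rewrite hornerM PE QE.
  have [->|nz] := eqVneq (\det (g + u%:M)) 0; first by rewrite mulr0.
  by rewrite k0 ?mul0r // unitmxE unitfE.
move/eqP; rewrite mulf_eq0 (negPf (monic_neq0 (char_poly_monic _))) orbF.
move/eqP=> P0.
by have := PE 0; rewrite P0 horner0 raddf0 addr0.
Qed.

Lemma word_form_units k (c w : X -> 'I_n) (S : {set X}) :
  word_form k (\sum_(y in S) delta_mx (w y) (c y)) =
  \sum_(f in family (splice [set: X] S)) k (c \o f) (w \o f).
Proof.
pose pick (f : {ffun X -> X}) (c' w' : {ffun X -> 'I_n}) :=
  (c' == [ffun x => c (f x)]) && (w' == [ffun x => w (f x)]).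
transitivity (\sum_(c' : {ffun X -> 'I_n}) \sum_(w' : {ffun X -> 'I_n})
    \sum_(f in family (splice [set: X] S)) k c' w' * (pick f c' w')%:R).
  apply: eq_bigr => c' _; apply: eq_bigr => w' _; rewrite -mulr_sumr.
  congr (_ * _).
  transitivity (\prod_x \sum_(y in splice setT S x)
      ((w' x == w y) && (c' x == c y))%:R : K).
    apply: eq_bigr => x _; rewrite summxE; apply: eq_big => y.
      by rewrite in_splice inE.
    by rewrite mxE.
  rewrite bigA_distr_big_dep; apply: eq_bigr => f _.
  have [/andP[/eqP-> /eqP->]|npick] := boolP (pick f c' w').
    by rewrite big1 // => x _; rewrite !ffunE !eqxx.
  have [x nx] : exists x, ~~ ((w' x == w (f x)) && (c' x == c (f x))).
    apply/existsP; rewrite -negb_forall; apply: contra npick => /forallP all.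
    by apply/andP; split; apply/eqP/ffunP => x; rewrite ffunE;
      have /andP[/eqP wx /eqP cx] := all x.
  by rewrite (bigD1 x) //= (negPf nx) mul0r.
under eq_bigr do rewrite exchange_big.
rewrite exchange_big; apply: eq_bigr => f _ /=.
rewrite (bigD1 [ffun x => c (f x)]) //= (bigD1 [ffun x => w (f x)]) //=.
rewrite /pick !eqxx mulr1 [X in _ + X + _]big1 => [|w' /negPf ->]; last first.
  by rewrite andbF mulr0.
rewrite [X in _ + _ + X]big1 => [|c' /negPf c'P]; last first.
  by rewrite big1 // => w' _; rewrite c'P mulr0.
by rewrite !addr0; congr k; apply/funext => x; rewrite ffunE.
Qed.

(** Polarization recovers the coefficients from the values at sums of matrix
    units. *)
Lemma polar_eq0 k (c w : X -> 'I_n) :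
  (forall g, g \in unitmx -> word_form k g = 0) -> polar k c w = 0.
Proof.
move=> /word_form_eq0 k0.
transitivity (\sum_(s : {perm X} | perm_on [set: X] s) k (c \o s) (w \o s)).
  by apply: eq_bigl => s; symmetry; apply/subsetP => x _; rewrite inE.
rewrite (sum_perm_splice [set: X] (fun f => k (c \o f) (w \o f))).
by rewrite big1 // => S _; rewrite -word_form_units k0 mulr0.
Qed.

(** The derivative at t = 0 replaces, in all possible ways, one factor taken
    from column j by the factor from the same row in column i; the coefficients
    of the resulting form are those of the statement. *)
Lemma word_form_shear_derivative k i j g : i != j ->
  (forall t, word_form k (g *m (1%:M + t *: delta_mx i j)) = word_form k g) ->
  word_form (fun c w => \sum_(x | c x == i) k (recolor c x j) w) g = 0.
Proof.
move=> nij inv_k.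
pose L (c w : X -> 'I_n) x : {poly K} :=
  (g (w x) (c x))%:P + (if c x == j then g (w x) i else 0) *: 'X.
pose P := \sum_(c : {ffun X -> 'I_n}) \sum_(w : {ffun X -> 'I_n})
  (k c w)%:P * \prod_x L c w x.
have PE : P = (word_form k g)%:P.
  apply/eqP; rewrite -subr_eq0; apply/eqP; apply: poly_fun_eq0 => t.
  rewrite hornerD hornerN hornerC -(inv_k t); apply/eqP; rewrite subr_eq0.
  apply/eqP; rewrite horner_sum; apply: eq_bigr => c _; rewrite horner_sum.
  apply: eq_bigr => w _; rewrite hornerM hornerC horner_prod.
  congr (_ * _); apply: eq_bigr => x _; rewrite !hornerE mulmxDr mulmx1 !mxE.
  congr (_ + _); rewrite (bigD1 i) //= big1 => [|a ai]; last first.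
    by rewrite !mxE (negPf ai) !mulr0.
  rewrite !mxE eqxx addr0 /=.
  by case: ifP; rewrite ?mulr1 ?mulr0 ?mul0r // mulrC.
have dP0 : P^`().[0] = 0 by rewrite PE derivC horner0.
rewrite -[RHS]dP0 raddf_sum /= horner_sum /word_form.
under [LHS]eq_bigr do under eq_bigr do rewrite /= mulr_suml.
under [RHS]eq_bigr => c _.
  rewrite raddf_sum /= horner_sum.
  under eq_bigr => w _.
    rewrite derivM derivC mul0r add0r deriv_prod ?index_enum_uniq //.
    rewrite hornerM hornerC horner_sum mulr_sumr.
    over.
  rewrite exchange_big /=; over.
under [LHS]eq_bigr do rewrite exchange_big /=.
rewrite [LHS](exchange_big_dep xpredT) //= [RHS]exchange_big /=.
apply: eq_bigr => x _.
rewrite [RHS](bigID (fun c : {ffun X -> 'I_n} => c x == j)) /=.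
rewrite [X in _ + X]big1 ?addr0 => [|c /negPf cx]; last first.
  apply: big1 => w _; rewrite /L cx scale0r addr0 derivC mul0r horner0.
  by rewrite mulr0.
pose rec (a : 'I_n) (c : {ffun X -> 'I_n}) : {ffun X -> 'I_n} :=
  [ffun y => recolor c x a y].
rewrite [RHS](reindex_onto (rec j) (rec i)) /=; last first.
  move=> c /eqP cx; apply/ffunP => y; rewrite !ffunE /recolor ffunE /recolor.
  by case: (eqVneq y x) => [->|] //; rewrite cx.
apply: eq_big => c.
  rewrite ffunE /recolor !eqxx /=; apply/eqP/eqP => [cx|<-].
    apply/ffunP => y; rewrite !ffunE /recolor ffunE /recolor.
    by case: (eqVneq y x) => [->|] //; rewrite cx.
  by rewrite ffunE /recolor eqxx.
move=> /eqP cx; apply: eq_bigr => w _; congr (k _ _ * _).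
  by apply/funext => y; rewrite ffunE.
rewrite (bigD1 x) //= cx mulrC hornerM horner_prod.
rewrite /L ffunE /recolor !eqxx derivD derivC derivZ derivX add0r.
rewrite hornerZ hornerC mulr1 mulrC; congr (_ * _).
apply: eq_bigr => y /negPf yx; rewrite ffunE /recolor yx.
by rewrite hornerD hornerC hornerZ hornerX mulr0 addr0.
Qed.

(** Invariance of a form under adding multiples of column i to column j, in
    terms of its polarization. *)
Lemma polar_raising k i j (c w : X -> 'I_n) : i != j ->
  (forall g t, g \in unitmx ->
     word_form k (g *m (1%:M + t *: delta_mx i j)) = word_form k g) ->
  \sum_(y | c y == i) polar k (recolor c y j) w = 0.
Proof.
move=> nij inv_k.
pose k' c w := \sum_(x | c x == i) k (recolor c x j) w.
rewrite -[RHS](@polar_eq0 k' c w) => [|g gU]; last first.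
  by apply: word_form_shear_derivative => // t; apply: inv_k.
rewrite /polar exchange_big; apply: eq_bigr => s _ /=.
rewrite (reindex_inj (@perm_inj _ s)); apply: eq_bigr => x _; congr k.
by apply/funext => y; rewrite /recolor /= (inj_eq perm_inj).
Qed.

End PolarForm.

(** * Block determinants with polynomial blocks *)

Lemma det_multilinear (R : comNzRingType) (D : nat) (J : finType)
    (Q : 'I_D -> {pred J}) (A : 'I_D -> J -> 'I_D -> R) :
  \det (\matrix_(r, x) \sum_(j in Q x) A x j r) =
  \sum_(f in family Q) \det (\matrix_(r, x) A x (f x) r).
Proof.
have detE (B : 'M[R]_D) : \det B =
    \sum_(s : {perm 'I_D}) (-1) ^+ s * \prod_x B (s x) x.
  rewrite -det_tr; apply: eq_bigr => s _; congr (_ * _).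
  by apply: eq_bigr => x _; rewrite mxE.
under [RHS]eq_bigr do rewrite detE.
rewrite detE [RHS]exchange_big; apply: eq_bigr => s _ /=.
rewrite -mulr_sumr; congr (_ * _).
under eq_bigr do rewrite mxE.
rewrite bigA_distr_big_dep; apply: eq_bigr => f _.
by apply: eq_bigr => x _; rewrite mxE.
Qed.

Lemma det_mxdiag (R : comNzRingType) m (p_ : 'I_m -> nat)
    (B : forall i, 'M[R]_(p_ i)) :
  \det (\mxdiag_i B i) = \prod_i \det (B i).
Proof.
elim: m p_ B => [|m IHm] p_ B.
  have det0 D (A : 'M[R]_D) : D = 0%N -> \det A = 1.
    by move=> D0; move: A; rewrite D0; exact: det_mx00.
  by rewrite [RHS]big_ord0 det0 // big_ord0.
rewrite mxdiag_recl; case: _ / mxsize_recl; rewrite castmx_id.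
by rewrite det_lblock IHm big_ord_recl.
Qed.

Section LinearClosed.
Variables (K : pzRingType) (T : Type).

Definition linear_closed (V : (T -> K) -> Prop) : Prop :=
  V (fun=> 0) /\
  forall a f h, V f -> V h -> V (fun t => a * f t + h t).

Variable V : (T -> K) -> Prop.
Hypothesis Vlin : linear_closed V.

Lemma linear_closedZ a f : V f -> V (fun t => a * f t).
Proof.
case: Vlin => V0 VD Vf; have := VD a _ _ Vf V0.
by under eq_fun do rewrite addr0.
Qed.

Lemma linear_closed_sum (I : Type) (s : seq I) (a : I -> K) (f : I -> T -> K) :
  (forall i, V (f i)) -> V (fun t => \sum_(i <- s) a i * f i t).
Proof.
case: Vlin => V0 VD Vf; elim: s => [|i s IHs].
  by under eq_fun do rewrite big_nil.
by under eq_fun do rewrite big_cons; apply: VD.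
Qed.

End LinearClosed.

(** The positions are the columns of a matrix with [d] blocks of [n.+1] rows
    each.  The part of column x in block p is column [w x] of the polynomial
    [b x p] at [N]. *)
Section BlockTensor.
Variables (K : numFieldType) (d n : nat).
Let X := 'I_(\sum_(p < d) n.+1).
Implicit Types (N g : 'M[K]_n.+1) (b : X -> 'I_d -> {poly K}).
Implicit Types (w c : X -> 'I_n.+1) (C S : {set X}).

Definition tensor_mx N b w : 'M[K]_(\sum_(p < d) n.+1) :=
  \matrix_(r, x) horner_mx N (b x (tagnat.sig1 r)) (tagnat.sig2 r) (w x).

Definition tensor_det N b w : K := \det (tensor_mx N b w).

Lemma det_colperm (D : nat) (A : 'M[K]_D) (s : {perm 'I_D}) :
  \det (\matrix_(r, x) A r (s x)) = (-1) ^+ s * \det A.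
Proof.
have -> : \matrix_(r, x) A r (s x) = col_perm s A.
  by apply/matrixP => r x; rewrite !mxE.
by rewrite col_permE det_mulmx det_perm odd_permV mulrC.
Qed.

(** Permuting the words and permuting the polynomials differ by a permutation
    of the columns of the matrix. *)
Lemma tensor_det_perm N b w (s : {perm X}) :
  tensor_det N b (w \o s) = (-1) ^+ s * tensor_det N (b \o (s^-1)%g) w.
Proof.
rewrite /tensor_det -det_colperm; congr (\det _).
by apply/matrixP => r x; rewrite !mxE /= permK.
Qed.

Definition spread C S b : X -> 'I_d -> {poly K} :=
  fun x p => \sum_(y in splice C S x) b y p.

(** Antisymmetrizing over the vectors is symmetrizing over the polynomials, and
    [tensor_det] is multilinear in the columns of polynomials [b x]. *)
Lemma alternate_tensor_det N b w C :
  alternate C (tensor_det N b) w =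
  \sum_(S : {set X} | S \subset C)
    (-1) ^+ #|C :\: S| * tensor_det N (spread C S b) w.
Proof.
rewrite /alternate (reindex_inj invg_inj) /=.
transitivity (\sum_(s : {perm X} | perm_on C s) tensor_det N (b \o s) w).
  apply: eq_big => [s|s _].
    apply/idP/idP => [|]; last exact: perm_onV.
    by move/perm_onV; rewrite invgK.
  by rewrite tensor_det_perm odd_permV mulrA -expr2 sqrr_sign mul1r invgK.
rewrite (sum_perm_splice C (fun f => tensor_det N (b \o f) w)).
apply: eq_bigr => S _; congr (_ * _).
rewrite /tensor_det /tensor_mx -(det_multilinear (splice C S)
  (fun x y r => horner_mx N (b y (tagnat.sig1 r)) (tagnat.sig2 r) (w x))).
congr (\det _); apply/matrixP => r x; rewrite !mxE /spread raddf_sum /=.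
by rewrite summxE.
Qed.

Definition constant_on (cols : seq (seq X)) b : Prop :=
  forall col x y, col \in cols -> x \in col -> y \in col -> b x = b y.

(** Stated for families of matrices [v t] and a linear space [V] of functions of
    [t], because the coefficients of the combination must not depend on the
    matrix. *)
Lemma alternates_tensor_det (T : Type) (V : (T -> K) -> Prop)
    (v : T -> 'M[K]_n.+1) w :
  linear_closed V ->
  forall cols done b, uniq (flatten (done ++ cols)) -> constant_on done b ->
  (forall b', constant_on (done ++ cols) b' ->
     V (fun t => tensor_det (v t) b' w)) ->
  V (fun t => alternates cols (tensor_det (v t) b) w).
Proof.
move=> Vlin; elim=> [|col cols IH] done b ucols bdone Vb /=.
  by apply: Vb; rewrite cats0.
pose a (S : {set X}) : K :=
  if S \subset [set x in col] then (-1) ^+ #|[set x in col] :\: S| else 0.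
have -> : (fun t => alternates cols
      (alternate [set x in col] (tensor_det (v t) b)) w) =
    (fun t => \sum_(S <- enum {set X}) a S *
       alternates cols (tensor_det (v t) (spread [set x in col] S b)) w).
  apply/funext => t; rewrite big_enum /=.
  rewrite -(alternates_sum _ _
    (fun S => tensor_det (v t) (spread [set x in col] S b))).
  congr (alternates _ _ _); apply/funext => u.
  rewrite alternate_tensor_det big_mkcond.
  by apply: eq_bigr => S _; rewrite /a; case: ifP; rewrite ?mul0r.
apply: linear_closed_sum => // S.
apply: (IH (rcons done col)); rewrite ?cat_rcons //.
move=> col' x y; rewrite mem_rcons inE.
move=> /predU1P[-> xcol ycol|col'd xcol ycol].
  by apply/funext => p; apply: eq_bigl => z; rewrite !in_splice !inE xcol ycol.
have spread_id z : z \in col' -> spread [set x in col] S b z = b z.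
  move=> zcol; apply/funext => p; rewrite /spread (big_pred1 z) // => u.
  rewrite in_splice inE ifN //; apply: contraTN ucols => zc.
  rewrite flatten_cat cat_uniq negb_and negb_and; apply/orP; right.
  apply/orP; left; rewrite negbK; apply/hasP; exists z.
    by rewrite /= mem_cat zc.
  by apply/flattenP; exists col'.
by rewrite !spread_id //; apply: bdone xcol ycol.
Qed.

End BlockTensor.

(** * Data and monomials as block determinants *)

(** Here the positions are divided into columns, along which the polynomials
    are constant and the word is 0, 1, 2 and so on.  Each such column is one
    column of blocks of the matrix of a datum, whose width is its length. *)
Section ColumnDatum.
Variables (K : numFieldType) (d n : nat).
Let X := 'I_(\sum_(p < d) n.+1).
Variables (c : X -> 'I_n.+1) (cols : seq (seq X)).
Variable b : X -> 'I_d -> {poly K}.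
Hypotheses (d_gt0 : (0 < d)%N) (colsP : all (is_column c) cols).
Hypotheses (ucols : uniq (flatten cols)) (colsT : forall x, x \in flatten cols).
Hypothesis b_const : constant_on cols b.

Let x0 : X.
Proof. by exists 0%N; rewrite sum_nat_const card_ord muln_gt0 d_gt0. Qed.

Let col (k : 'I_(size cols)) : seq X := nth [::] cols k.

Let col_in k : col k \in cols. Proof. exact: mem_nth. Qed.

Lemma column_colors k : [seq c x : nat | x <- col k] = iota 0 (size (col k)).
Proof. by have /andP[_ /eqP] := allP colsP _ (col_in k). Qed.

Lemma column_color k l :
  (l < size (col k))%N -> c (nth x0 (col k) l) = l :> nat.
Proof.
by move=> lt_l; rewrite -(nth_map x0 0%N (fun x => c x : nat)) // column_colors
  nth_iota.
Qed.

Lemma size_column_gt0 k : (0 < size (col k))%N.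
Proof. by have /andP[] := allP colsP _ (col_in k). Qed.

Lemma size_column k : (size (col k) < n.+2)%N.
Proof.
have := size_column_gt0 k; case E: (size _) => [//|l] _.
by rewrite !ltnS -(@column_color k l) ?E // -ltnS.
Qed.

Lemma cols_gt0 : (0 < size cols)%N.
Proof. by have := colsT x0; case: cols. Qed.

Lemma sum_size_columns :
  (\sum_k Ordinal (size_column k) = \sum_(p < d) (ord_max : 'I_n.+2))%N.
Proof.
transitivity (size (flatten cols)).
  by rewrite size_flatten /shape sumnE big_map (big_nth [::]) big_mkord.
rewrite -[RHS]card_ord -(card_uniqP ucols) -[RHS]cardsT.
by rewrite cardsT; apply: eq_card => x; rewrite colsT.
Qed.

Definition column_datum : datum K n.+1 :=
  @Datum K n.+1 d (size cols) d_gt0 cols_gt0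
    (fun=> ord_max) (fun k => Ordinal (size_column k))
    (fun=> isT) size_column_gt0 sum_size_columns
    (fun p k => b (nth x0 (col k) 0) p).

(** The sign is that of the permutation that lists the positions column by
    column. *)
Lemma tensor_det_column_datum :
  exists (P : datum K n.+1) (s : bool), forall N : nilcone K n.+1,
    tensor_det (val N) b c = (-1) ^+ s * datum_fun P N.
Proof.
pose q (y : X) := cast_ord (esym sum_size_columns) y.
pose pos (y : X) : X := nth x0 (col (tagnat.sig1 (q y))) (tagnat.sig2 (q y)).
have pos_surj x : exists y, pos y = x.
  have /flattenP[cl /(nthP [::])[k lt_k <-] xk] := colsT x.
  have lt_l := xk; rewrite -index_mem in lt_l.
  pose y := @tagnat.Rank _ (fun k => Ordinal (size_column k) : nat)
    (Ordinal lt_k) (Ordinal lt_l).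
  have y1 : tagnat.sig1 y = Ordinal lt_k by rewrite tagnat.Rank1K.
  have y2 : tagnat.sig2 y = index x (nth [::] cols k) :> nat.
    by rewrite tagnat.Rank2K.
  exists (cast_ord sum_size_columns y).
  by rewrite /pos /q cast_ordK y2 y1 nth_index.
have [g gK] := choice pos_surj.
have pos_inj : injective pos.
  exact: bij_inj (bij_can_bij (injF_bij (can_inj gK)) gK).
exists column_datum; exists (perm pos_inj : bool) => N.
rewrite /datum_fun.
have -> : datum_mx column_datum (val N) =
    \matrix_(r, y) tensor_mx (val N) b c r (perm pos_inj y).
  apply/matrixP => r y; rewrite /datum_mx castmxE !mxE permE /=.
  rewrite cast_ord_id; set k := tagnat.sig1 (cast_ord _ y).
  have lt_l : (tagnat.sig2 (q y) < size (col k))%N by exact: ltn_ord.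
  have -> : b (nth x0 (col k) 0) = b (pos y).
    by apply: (b_const (col_in k)); rewrite mem_nth // size_column_gt0.
  congr (fun_of_matrix _ _ _); apply: val_inj => /=; first by rewrite subnn.
  by rewrite column_color.
by rewrite det_colperm mulrA -expr2 sqrr_sign mul1r.
Qed.
End ColumnDatum.

(** A monomial of degree at most [d] is a product of [d] slots, each holding a
    matrix entry or, for [None], the constant 1. *)
Section Slots.
Variables (K : numFieldType) (n : nat).
Implicit Types (o : option ('I_n.+1 * 'I_n.+1)) (N g : 'M[K]_n.+1).

Definition slot_val o N : K := if o is Some (i, j) then N i j else 1.

Definition slot_color o (l : 'I_n.+1) : 'I_n.+1 :=
  if o is Some (i, j) then (if l == i then j else l) else l.

Definition slot_poly o (l : 'I_n.+1) : {poly K} :=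
  if o is Some (i, j) then (if l == i then 'X else 1) else 1.

Lemma det_replace_col (i : 'I_n.+1) (v : 'I_n.+1 -> K) :
  \det (\matrix_(a, l) (if l == i then v a else (a == l)%:R)) = v i.
Proof.
set E := \matrix_(_, _) _; rewrite (expand_det_col E i).
rewrite (eq_bigr (fun a => v a * (a == i)%:R)) => [|a _].
  rewrite (bigD1 i) //= eqxx mulr1 big1 ?addr0 // => a /negPf->.
  by rewrite mulr0.
rewrite mxE eqxx; congr (_ * _).
have -> : cofactor E a i = cofactor 1%:M a i.
  congr (_ * \det _); apply/matrixP => p l; rewrite !mxE.
  by rewrite eq_sym (negPf (neq_lift _ _)).
have := congr1 (fun M : 'M[K]_n.+1 => M i a) (adj1 _ _).
by rewrite !mxE eq_sym => <-.
Qed.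

(** Cramer's rule: the matrix on the left is [g] times the identity matrix with
    column i replaced by column j of the conjugate of [N]. *)
Lemma slot_det o N g : g \in unitmx ->
  \det (\matrix_(a, l) (horner_mx N (slot_poly o l) *m g) a (slot_color o l)) =
  \det g * slot_val o (invmx g *m N *m g).
Proof.
move=> gU; case: o => [[i j]|] /=; last first.
  rewrite mulr1 rmorph1; congr (\det _).
  by apply/matrixP => a l; rewrite mxE mul1mx.
set M := invmx g *m N *m g.
rewrite -[M i j](det_replace_col i (fun a => M a j)) -det_mulmx; congr (\det _).
apply/matrixP => a l; rewrite mxE [RHS]mxE; have [->|nli] := eqVneq l i.
  rewrite horner_mx_X -[N](mulKVmx gU) -!mulmxA mxE; apply: eq_bigr => e _.
  by rewrite [X in _ = _ * X]mxE eqxx /M -mulmxA.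
rewrite rmorph1 mul1mx (bigD1 l) //= mxE (negPf nli) eqxx mulr1.
by rewrite big1 ?addr0 // => e /negPf el; rewrite mxE (negPf nli) el mulr0.
Qed.

Variable d : nat.
Let X := 'I_(\sum_(p < d) n.+1).
Implicit Types (al : 'I_d -> option ('I_n.+1 * 'I_n.+1)).

Definition slots_color al (x : X) : 'I_n.+1 :=
  slot_color (al (tagnat.sig1 x)) (tagnat.sig2 x).

Definition slots_poly al (x : X) (p : 'I_d) : {poly K} :=
  if p == tagnat.sig1 x then slot_poly (al p) (tagnat.sig2 x) else 0.

(** The matrix is block diagonal, with one block for each slot. *)
Lemma slots_det al N g : g \in unitmx ->
  \det (\matrix_(r, x) (horner_mx N (slots_poly al x (tagnat.sig1 r)) *m g)
           (tagnat.sig2 r) (slots_color al x)) =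
  \det g ^+ d * \prod_p slot_val (al p) (invmx g *m N *m g).
Proof.
move=> gU; pose W p := \matrix_(a, l)
  (horner_mx N (slot_poly (al p) l) *m g) a (slot_color (al p) l).
transitivity (\det (\mxdiag_p W p)).
  congr (\det _); apply/matrixP => r x.
  rewrite mxE [RHS]mxE /slots_poly /slots_color.
  case: eqVneq => [e|_]; last by rewrite rmorph0 mul0mx !mxE.
  by rewrite conform_mx_id e [RHS]mxE.
rewrite det_mxdiag (eq_bigr _ (fun p _ => slot_det (al p) N gU)).
by rewrite big_split /= prodr_const card_ord.
Qed.

Lemma slots_det_expand al N g :
  \det (\matrix_(r, x) (horner_mx N (slots_poly al x (tagnat.sig1 r)) *m g)
           (tagnat.sig2 r) (slots_color al x)) =
  \sum_(w : {ffun X -> 'I_n.+1})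
     tensor_det N (slots_poly al) w * \prod_x g (w x) (slots_color al x).
Proof.
pose A (x : X) (j : 'I_n.+1) (r : X) :=
  horner_mx N (slots_poly al x (tagnat.sig1 r)) (tagnat.sig2 r) j *
  g j (slots_color al x).
transitivity (\det (\matrix_(r, x) \sum_(j in predT) A x j r)).
  by congr (\det _); apply/matrixP => r x; rewrite !mxE.
rewrite (det_multilinear (fun=> predT)).
apply: eq_big => [w|w _]; first by apply/familyP.
have -> : \matrix_(r, x) A x (w x) r = tensor_mx N (slots_poly al) w *m
    diag_mx (\row_x g (w x) (slots_color al x)).
  apply/matrixP => r x; rewrite mul_mx_diag !mxE.
  by [].
rewrite det_mulmx det_diag; congr (_ * _).
by apply: eq_bigr => x _; rewrite mxE.
Qed.

End Slots.

(** * Shears and characters *)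

Section Shears.
Variables (K : numFieldType) (n : nat).
Variables (i j : 'I_n.+1) (lt_ij : (i < j)%N).

Definition shear t : 'M[K]_n.+1 := 1%:M + t *: delta_mx i j.

Lemma shear_upper t (k l : 'I_n.+1) : (l <= k)%N -> shear t k l = (k == l)%:R.
Proof.
move=> le_lk; rewrite !mxE.
have [ki|] := eqVneq k i; last by rewrite mulr0 addr0.
have [lj|] := eqVneq l j; last by rewrite mulr0 addr0.
by move: lt_ij; rewrite -ki -lj ltnNge le_lk.
Qed.

Lemma det_shear t : \det (shear t) = 1.
Proof.
rewrite -det_tr det_trig.
  by rewrite big1 // => l _; rewrite mxE shear_upper ?eqxx.
apply/is_trig_mxP => k l lt_kl; rewrite mxE shear_upper ?(ltnW lt_kl) //.
by rewrite -val_eqE gtn_eqF.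
Qed.

Lemma shear_unit t : shear t \in unitmx.
Proof. by rewrite unitmxE det_shear unitr1. Qed.

Lemma shear_borel t : shear t \in borel K n.+1.
Proof.
apply/andP; split; first exact: shear_unit.
apply/is_trig_mxP => k l lt_kl; rewrite mxE shear_upper ?(ltnW lt_kl) //.
by rewrite -val_eqE gtn_eqF.
Qed.

Lemma shear0 : shear 0 = 1%:M. Proof. by rewrite /shear scale0r addr0. Qed.

Lemma shearM s t : shear s *m shear t = shear (s + t).
Proof.
rewrite /shear mulmxDl mul1mx mulmxDr mulmx1 -scalemxAl -scalemxAr.
rewrite mul_delta_mx_0 ?scaler0 ?addr0; last by rewrite -val_eqE gtn_eqF.
by rewrite -addrA -scalerDl [t + s]addrC.
Qed.

(** Shears have determinant 1, so a character is a polynomial in t on them; this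
    polynomial has an inverse, its value at - t, and is therefore constant. *)
Lemma character_shear (chi : 'M[K]_n.+1 -> K) t :
  borel_character chi -> chi (shear t) = 1.
Proof.
move=> [chi0 chiM [p [k pE]]].
have shear0B := shear_borel 0; rewrite shear0 in shear0B.
have chi1 : chi 1%:M = 1.
  by apply: (mulfI (chi0 _ shear0B)); rewrite mulr1 -chiM ?mulmx1.
pose q : {poly K} := \sum_(m <- msupp p) p@_m *: \prod_v
  ((mxvec (1%:M : 'M[K]_n.+1) 0 v)%:P +
   (mxvec (delta_mx i j : 'M[K]_n.+1) 0 v) *: 'X) ^+ m v.
have qE s : chi (shear s) = q.[s].
  rewrite pE ?shear_borel // det_shear expr1n divr1 mevalE horner_sum.
  apply: eq_bigr => m _; rewrite hornerZ horner_prod; congr (_ * _).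
  apply: eq_bigr => v _; rewrite horner_exp; congr (_ ^+ _).
  by rewrite !hornerE /shear linearD linearZ !mxE [_ * s]mulrC.
have : q * (q \Po (- 'X)) = 1.
  apply/eqP; rewrite -subr_eq0; apply/eqP/poly_fun_eq0 => s.
  rewrite hornerD hornerN hornerM horner_comp !hornerE -!qE.
  by rewrite -chiM ?shear_borel // shearM subrr shear0 chi1 subrr.
move/(congr1 (fun r : {poly K} => size r == 1%N)).
rewrite size_mul_eq1 size_poly1 => /andP[/size_poly1P[c _ qc] _].
by rewrite qE qc hornerC -(hornerC c 0) -qc -qE shear0 chi1.
Qed.

End Shears.

Lemma nilcone_conj_unit (K : fieldType) n (g N : 'M[K]_n.+1) : g \in unitmx ->
  N \in nilcone K n.+1 -> invmx g *m N *m g \in nilcone K n.+1.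
Proof.
move=> gU /set_mem[k Nk]; apply/mem_set; exists k.
suff -> : (invmx g *m N *m g) ^+ k = invmx g *m N ^+ k *m g.
  by rewrite Nk mulmx0 mul0mx.
elim: k {Nk} => [|k IHk]; first by rewrite !expr0 mulmx1 mulVmx.
by rewrite !exprSr IHk -!mulmxE !mulmxA mulmxK.
Qed.

(** * Functions invariant under shears *)

Section SlotExpansion.
Variables (K : numFieldType) (n : nat).

Lemma mpoly_slots (p : {mpoly K[n.+1 * n.+1]}) :
  exists (d r : nat) (a : 'I_r -> K)
         (al : 'I_r -> 'I_d -> option ('I_n.+1 * 'I_n.+1)), (0 < d)%N /\
    forall N : 'M[K]_n.+1,
      p.@[mxvec N 0] = \sum_i a i * \prod_q slot_val (al i q) N.
Proof.
have /choice[idx idxE] (v : 'I_(n.+1 * n.+1)) :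
    exists ij : 'I_n.+1 * 'I_n.+1, v = mxvec_index ij.1 ij.2.
  by case/mxvec_indexP: v => i j; exists (i, j).
pose L (m : 'X_{1..n.+1 * n.+1}) :=
  flatten [seq nseq (m v) (Some (idx v)) | v <- enum 'I_(n.+1 * n.+1)].
pose d := (\max_(m <- msupp p) size (L m)).+1.
pose m_ (i : 'I_(size (msupp p))) := tnth (in_tuple (msupp p)) i.
exists d, (size (msupp p)), (fun i => p@_(m_ i)).
exists (fun i q => nth None (L (m_ i)) q); split=> // N.
rewrite mevalE (big_tnth _ _ (msupp p)); apply: eq_bigr => i _; congr (_ * _).
have le_d : (size (L (m_ i)) <= d)%N.
  apply/leqW/(@leq_bigmax_seq _ _ xpredT (fun m => size (L m))) => //.
  exact: mem_tnth.
rewrite -(big_mkord xpredT (fun q => slot_val (nth None (L (m_ i)) q) N)).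
rewrite (big_cat_nat (leq0n _) le_d) /=.
rewrite [X in _ * X]big1_seq => [|q /andP[_]]; last first.
  by rewrite mem_index_iota => /andP[le_q _]; rewrite nth_default.
rewrite mulr1 -(big_nth None xpredT (fun o => slot_val o N)).
rewrite /L big_flatten /= big_map big_enum /=; apply: eq_bigr => v _.
rewrite big_nseq iter_mulr_1 {1}(idxE v) mxvecE.
by case: (idx v).
Qed.

End SlotExpansion.

Section ShearInvariants.
Variables (K : numFieldType) (n d r : nat) (a : 'I_r -> K).
Variable al : 'I_r -> 'I_d -> option ('I_n.+1 * 'I_n.+1).
Let X := 'I_(\sum_(p < d) n.+1).
Implicit Types (N g : 'M[K]_n.+1) (w c : X -> 'I_n.+1).

Let F N : K := \sum_i a i * \prod_q slot_val (al i q) N.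

(** The coefficients, in the sense of [word_form], of the polynomial in [g] that
    is the product of [\det g ^+ d] and the value of [F] at [g^-1 N g]. *)
Definition slots_coef N c w : K :=
  \sum_i (a i * [forall x, c x == slots_color (al i) x]%:R) *
    tensor_det N (slots_poly K (al i)) w.

Lemma word_form_slots N g : g \in unitmx ->
  word_form (slots_coef N) g = \det g ^+ d * F (invmx g *m N *m g).
Proof.
move=> gU; rewrite mulr_sumr.
transitivity (\sum_i a i *
  \sum_(w : {ffun X -> 'I_n.+1}) tensor_det N (slots_poly K (al i)) w *
     \prod_x g (w x) (slots_color (al i) x)).
  rewrite /word_form; under eq_bigr do under eq_bigr do rewrite mulr_suml.
  under eq_bigr do rewrite exchange_big.
  rewrite exchange_big; apply: eq_bigr => i _ /=.
  rewrite (bigD1 [ffun x => slots_color (al i) x]) //= [X in _ + X]big1.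
    rewrite addr0 mulr_sumr; apply: eq_bigr => w _.
    rewrite (introT forallP) => [|x]; last by rewrite ffunE.
    rewrite mulr1 mulrA; congr (_ * _).
    by apply: eq_bigr => x _; rewrite ffunE.
  move=> c' /eqP c'P; apply: big1 => w _.
  rewrite (introF forallP) ?mulr0 ?mul0r // => c'E; apply: c'P.
  by apply/ffunP => x; rewrite ffunE; apply/eqP.
apply: eq_bigr => i _.
by rewrite -slots_det_expand slots_det // mulrCA.
Qed.

Lemma polar_perm (k : (X -> 'I_n.+1) -> (X -> 'I_n.+1) -> K) c w
    (t : {perm X}) : polar k (c \o t) (w \o t) = polar k c w.
Proof.
rewrite [RHS](reindex_inj (mulIg t)); apply: eq_bigr => s _.
by congr k; apply/funext => x /=; rewrite permM.
Qed.

(** Euler's formula for the value at [g = 1] of a homogeneous form in terms of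
    its derivatives; the derivatives along entries off the diagonal do not
    contribute. *)
Lemma sum_polar_diagonal N :
  \sum_(c : {ffun X -> 'I_n.+1}) polar (slots_coef N) c c =
  #|{perm X}|%:R * F N.
Proof.
rewrite exchange_big /=.
transitivity (\sum_(s : {perm X}) F N); last by rewrite sumr_const mulr_natl.
apply: eq_bigr => s _.
rewrite (reindex_inj (h := fun c : {ffun X -> 'I_n.+1} =>
   [ffun x => c ((s^-1)%g x)])); last first.
  move=> c c' /ffunP e; apply/ffunP => x.
  by have := e (s x); rewrite !ffunE permK.
transitivity (\sum_(c : {ffun X -> 'I_n.+1}) slots_coef N c c).
  apply: eq_bigr => c _; congr slots_coef; apply/funext => x /=;
    by rewrite ffunE permK.
rewrite exchange_big; apply: eq_bigr => i _ /=.
rewrite (bigD1 [ffun x => slots_color (al i) x]) //= [X in _ + X]big1.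
  rewrite (introT forallP) => [|x]; last by rewrite ffunE.
  rewrite addr0 mulr1; congr (_ * _).
  have := slots_det (al i) N (unitmx1 _ _).
  rewrite det1 expr1n mul1r invmx1 mul1mx mulmx1 => <-; congr (\det _).
  by apply/matrixP => p x; rewrite [LHS]mxE [RHS]mxE mulmx1 ffunE.
move=> c' /eqP c'P; rewrite (introF forallP) ?mulr0 ?mul0r // => c'E.
by apply: c'P; apply/ffunP => x; rewrite ffunE; apply/eqP.
Qed.

Hypothesis F_shear : forall (i j : 'I_n.+1) t N, (i < j)%N ->
  N \in nilcone K n.+1 ->
  F (invmx (shear i j t) *m N *m shear i j t) = F N.

(** Multiplying [g] by a shear conjugates [g^-1 N g] by this shear, which leaves
    [F] unchanged, so [polar_raising] applies.  Recolouring x from [c x] to i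
    and then a position y of colour i to [c x] is exchanging x and y. *)
Lemma polar_highest_weight N c : N \in nilcone K n.+1 ->
  highest_weight c [set: X] (polar (slots_coef N) c).
Proof.
move=> nilN; split=> [w x y _ _ cxy|w x i _ lt_i].
  rewrite -[RHS](polar_perm _ _ _ (tperm x y)); congr polar.
  by apply/funext => z /=; case: tpermP => // ->.
have nij : i != c x by apply: contraTneq lt_i => ->; rewrite ltnn.
have form_shear g t : g \in unitmx ->
    word_form (slots_coef N) (g *m shear i (c x) t) =
    word_form (slots_coef N) g.
  move=> gU; have uU := shear_unit lt_i t.
  rewrite !word_form_slots ?unitmx_mul ?gU // det_mulmx det_shear // mulr1.
  congr (_ * _).
  rewrite -(F_shear t lt_i (nilcone_conj_unit gU nilN)); congr F.
  have -> : invmx (g *m shear i (c x) t) = invmx (shear i (c x) t) *m invmx g.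
    exact: invrM.
  by rewrite !mulmxA.
have := polar_raising (recolor c x i) w nij form_shear.
rewrite (bigD1 x) /=; last by rewrite /recolor eqxx.
have -> : recolor (recolor c x i) x (c x) = c.
  by apply/funext => y; rewrite /recolor; case: eqVneq => // ->.
move=> rel; rewrite -[RHS]rel; congr (_ + _).
apply: eq_big => [y|y /andP[_ /eqP cy]].
  rewrite in_setT /= /recolor.
  case: (eqVneq y x) => [->|_]; last by rewrite andbT.
  by rewrite andbF eq_sym; apply: negPf.
rewrite -(polar_perm _ c (w \o tperm x y) (tperm x y)); congr polar.
  apply/funext => z /=; rewrite /recolor.
  case: tpermP => [->|->|/eqP nx /eqP ny].
  - by rewrite eqxx; case: eqVneq => [->|_] //; rewrite cy.
  - by rewrite eqxx.
  by rewrite (negPf nx) (negPf ny).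
by apply/funext => z /=; rewrite tpermK.
Qed.

End ShearInvariants.

Section Span.
Variables (K : numFieldType) (n : nat).
Variable V : (nilcone K n.+1 -> K) -> Prop.
Hypothesis Vlin : linear_closed V.
Hypothesis Vdatum : forall P : datum K n.+1, V (datum_fun P).

(** The tableau and the factor given by [young_straightening] depend on [c]
    only, so one combination of data serves for all [N]. *)
Lemma polar_diagonal_span d r (a : 'I_r -> K)
    (al : 'I_r -> 'I_d -> option ('I_n.+1 * 'I_n.+1)) c :
  (0 < d)%N ->
  (forall N : nilcone K n.+1,
     highest_weight c [set: _] (polar (slots_coef a al (val N)) c)) ->
  V (fun N => polar (slots_coef a al (val N)) c c).
Proof.
move=> d_gt0 hw.
case: (young_straightening K c [set: _]) => [zero|[q [cols]]].
  suff -> : (fun N : nilcone K n.+1 => polar (slots_coef a al (val N)) c c)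
    = fun=> 0 by case: Vlin.
  by apply/funext => N; apply: zero.
case=> colsP ucols colsT qP.
pose I := ({perm 'I_(\sum_(p < d) n.+1)} * 'I_r)%type.
pose e (i : I) := a i.2 * [forall x, c (i.1 x) == slots_color (al i.2) x]%:R *
  (-1) ^+ i.1.
pose b (i : I) := slots_poly K (al i.2) \o (i.1^-1)%g.
have polarE (N : nilcone K n.+1) : polar (slots_coef a al (val N)) c =
    fun w => \sum_i e i * tensor_det (val N) (b i) w.
  apply/funext => w; rewrite /polar /slots_coef pair_big /=.
  apply: eq_bigr => i _; rewrite tensor_det_perm mulrA; congr (_ * _ * _).
have -> : (fun N : nilcone K n.+1 => polar (slots_coef a al (val N)) c c) =
    fun N => q * \sum_i e i * alternates cols (tensor_det (val N) (b i)) c.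
  apply/funext => N; rewrite qP //; congr (_ * _).
  by rewrite polarE alternates_sum.
apply: linear_closedZ => //; apply: linear_closed_sum => // i.
apply: (@alternates_tensor_det _ _ _ _ V _ c Vlin cols [::]) => // b' b'P.
have colsX x : x \in flatten cols by rewrite colsT in_setT.
have [P [s PE]] := tensor_det_column_datum d_gt0 colsP ucols colsX b'P.
have -> : (fun N : nilcone K n.+1 => tensor_det (val N) b' c) = fun N =>
    (-1) ^+ s * datum_fun P N.
  by apply/funext => N; rewrite PE.
exact: linear_closedZ.
Qed.

Lemma shear_invariant_span (p : {mpoly K[n.+1 * n.+1]}) :
  (forall (i j : 'I_n.+1) t N, (i < j)%N -> N \in nilcone K n.+1 ->
     p.@[mxvec (invmx (shear i j t) *m N *m shear i j t) 0] =
     p.@[mxvec N 0]) ->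
  V (fun N => p.@[mxvec (val N) 0]).
Proof.
move=> p_shear; have [d [r [a [al [d_gt0 pE]]]]] := mpoly_slots p.
pose X := 'I_(\sum_(q < d) n.+1).
have -> : (fun N : nilcone K n.+1 => p.@[mxvec (val N) 0]) = fun N =>
    #|{perm X}|%:R^-1 *
    \sum_(c : {ffun X -> 'I_n.+1}) 1 * polar (slots_coef a al (val N)) c c.
  apply/funext => N; under [X in _ = _ * X]eq_bigr do rewrite mul1r.
  rewrite sum_polar_diagonal -pE mulKf // pnatr_eq0 -lt0n.
  by apply/card_gt0P; exists 1%g.
apply: linear_closedZ => //; apply: linear_closed_sum => // c.
apply: polar_diagonal_span => // N.
apply: polar_highest_weight; last exact: valP.
by move=> i j t M lt_ij nilM; rewrite -!pE; apply: p_shear.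
Qed.

End Span.

(** * Semi-invariance of the determinants attached to data *)

Section UpperTriangular.
Variables (K : fieldType) (n : nat).
Implicit Types (g h M : 'M[K]_n.+1).

Lemma borel_lower0 g (i j : 'I_n.+1) :
  g \in borel K n.+1 -> (j < i)%N -> g i j = 0.
Proof. by case/andP=> _ /is_trig_mxP g0 /g0; rewrite mxE. Qed.

Lemma borel_det g : g \in borel K n.+1 -> \det g = \prod_i g i i.
Proof.
case/andP=> _ gT; rewrite -det_tr det_trig //.
by apply: eq_bigr => i _; rewrite mxE.
Qed.

Lemma borel_det_neq0 g : g \in borel K n.+1 -> \det g != 0.
Proof. by case/andP; rewrite unitmxE unitfE. Qed.

Lemma borel_diag_neq0 g i : g \in borel K n.+1 -> g i i != 0.
Proof.
move=> gB; have := borel_det_neq0 gB; rewrite borel_det //.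
by move/prodf_neq0 => /(_ i isT).
Qed.

Lemma borel_diagM g h i : g \in borel K n.+1 -> h \in borel K n.+1 ->
  (g *m h) i i = g i i * h i i.
Proof.
move=> gB hB; rewrite mxE (bigD1 i) //= big1 ?addr0 // => j ji.
have [lt_ji|lt_ij|/val_inj e] := ltngtP j i; last by rewrite e eqxx in ji.
  by rewrite (borel_lower0 gB) // mul0r.
by rewrite (borel_lower0 hB) // mulr0.
Qed.

Definition tail_ord (a : 'I_n.+2) (i : 'I_a) : 'I_n.+1 :=
  cast_ord (subnK (leq_ord a)) (rshift (n.+1 - a) i).

Definition head_ord (b : 'I_n.+2) (j : 'I_b) : 'I_n.+1 :=
  widen_ord (leq_ord b) j.

Lemma corner_mxE (a b : 'I_n.+2) M :
  corner_mx a b M = mxsub (@tail_ord a) (@head_ord b) M.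
Proof. by apply/matrixP => i j; rewrite !mxE. Qed.

Lemma corner_mulr (a b : 'I_n.+2) M g : g \in borel K n.+1 ->
  corner_mx a b (M *m g) =
  corner_mx a b M *m mxsub (@head_ord b) (@head_ord b) g.
Proof.
move=> gB; rewrite !corner_mxE; apply/matrixP => i j; rewrite !mxE.
rewrite (bigID (fun k : 'I_n.+1 => (k < b)%N)) /= [X in _ + X]big1 ?addr0.
  rewrite (big_ord_narrow (leq_ord b)); apply: eq_bigr => k _.
  by rewrite !mxE.
move=> k; rewrite -leqNgt => le_bk; rewrite (borel_lower0 gB) ?mulr0 //.
exact: leq_trans (ltn_ord j) le_bk.
Qed.

Lemma corner_mull (a b : 'I_n.+2) M g : g \in borel K n.+1 ->
  corner_mx a b (g *m M) =
  mxsub (@tail_ord a) (@tail_ord a) g *m corner_mx a b M.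
Proof.
move=> gB; rewrite !corner_mxE; apply/matrixP => i j; rewrite !mxE.
rewrite (reindex (cast_ord (subnK (leq_ord a)))) /=; last first.
  exists (cast_ord (esym (subnK (leq_ord a)))) => k _;
    by rewrite ?cast_ordK ?cast_ordKV.
rewrite big_split_ord /= big1 ?add0r => [|k _].
  by apply: eq_bigr => k _; rewrite !mxE.
rewrite (borel_lower0 gB) ?mul0r //=.
by apply: leq_trans (ltn_ord k) _; rewrite leq_addr.
Qed.

Lemma det_tail_block (a : 'I_n.+2) g : g \in borel K n.+1 ->
  \det (mxsub (@tail_ord a) (@tail_ord a) g) =
  \prod_(i < a) g (tail_ord i) (tail_ord i).
Proof.
move=> gB; rewrite -det_tr det_trig.
  by apply: eq_bigr => i _; rewrite !mxE.
apply/is_trig_mxP => i j lt_ij; rewrite !mxE (borel_lower0 gB) //=.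
by rewrite ltn_add2l.
Qed.

Lemma det_head_block (b : 'I_n.+2) g : g \in borel K n.+1 ->
  \det (mxsub (@head_ord b) (@head_ord b) g) =
  \prod_(j < b) g (head_ord j) (head_ord j).
Proof.
move=> gB; rewrite -det_tr det_trig.
  by apply: eq_bigr => i _; rewrite !mxE.
by apply/is_trig_mxP => i j lt_ij; rewrite !mxE (borel_lower0 gB).
Qed.

End UpperTriangular.

Section DatumSemiInvariant.
Variables (K : fieldType) (n : nat) (P : datum K n.+1).
Implicit Types (g h : 'M[K]_n.+1).

Definition datum_weight g : K :=
  (\prod_i \prod_(l < height P i) g (tail_ord l) (tail_ord l)) /
  (\prod_j \prod_(l < width P j) g (head_ord l) (head_ord l)).

Lemma mpoly_entry g i : ('X_(mxvec_index i i)).@[mxvec g 0] = g i i.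
Proof. by rewrite mevalXU mxvecE. Qed.

(** The inverse of a diagonal entry of an upper triangular matrix is the product
    of the other diagonal entries divided by the determinant. *)
Lemma datum_weight_character : borel_character datum_weight.
Proof.
split=> [g gB|g h gB hB|].
- rewrite mulf_neq0 ?invr_neq0 //; apply/prodf_neq0 => i _;
    by apply/prodf_neq0 => l _; apply: borel_diag_neq0.
- rewrite /datum_weight mulrACA -invfM -!big_split /=.
  by congr (_ / _); apply: eq_bigr => i _; rewrite -big_split /=;
    apply: eq_bigr => l _; rewrite borel_diagM.
exists ((\prod_i \prod_(l < height P i)
           'X_(mxvec_index (tail_ord l) (tail_ord l))) *
        (\prod_j \prod_(l < n.+1 | (width P j <= l)%N) 'X_(mxvec_index l l))).
exists (ncols P) => g gB.
rewrite rmorphM !rmorph_prod /=.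
under [in X in _ = X * _ / _]eq_bigr do rewrite rmorph_prod /=.
under [in X in _ = _ * X / _]eq_bigr do rewrite rmorph_prod /=.
rewrite -mulrA; congr (_ * _).
  by apply: eq_bigr => i _; apply: eq_bigr => l _; rewrite mpoly_entry.
have -> : \det g ^+ ncols P = \prod_(j < ncols P) \det g.
  by rewrite prodr_const card_ord.
rewrite -prodfV -[RHS]prodf_div; apply: eq_bigr => j _.
rewrite borel_det //.
rewrite [X in _ = _ / X](bigID (fun l : 'I_n.+1 => (l < width P j)%N)) /=.
rewrite (big_ord_narrow (leq_ord (width P j))) /=.
under [X in _ = X / _]eq_bigr do rewrite mpoly_entry.
under [X in _ = _ / (_ * X)]eq_bigl do rewrite -leqNgt.
rewrite invfM mulrC mulfVK //; apply/prodf_neq0 => l _.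
exact: borel_diag_neq0.
Qed.

(** If [M] is the conjugate of [N] by [g], then [p(M) g = g p(N)] for every
    polynomial [p], which avoids restricting the inverse of [g] to blocks. *)
Lemma det_datum_mx_conj g N : g \in borel K n.+1 ->
  \det (datum_mx P (g *m N *m invmx g)) = datum_weight g * \det (datum_mx P N).
Proof.
move=> gB; have gU : g \in unitmx by case/andP: gB.
have hornerJ p : horner_mx (g *m N *m invmx g) p *m g = g *m horner_mx N p.
  set M := g *m N *m invmx g; have MJ : M *m g = g *m N by rewrite mulmxKV.
  elim/poly_ind: p => [|p c IHp]; first by rewrite !rmorph0 mul0mx mulmx0.
  rewrite !rmorphD !rmorphM /= !horner_mx_X !horner_mx_C mulmxDl mulmxDr.
  congr (_ + _); last by rewrite scalar_mxC.
  by rewrite -!mulmxE -mulmxA MJ mulmxA IHp mulmxA.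
have castE m k (e : m = k) (A B : 'M[K]_(k, m)) D E : A *m D = E *m B ->
    \det (castmx (erefl, e) A) * \det D = \det E * \det (castmx (erefl, e) B).
  move: A B D E; case: k / e => A B D E AE.
  by rewrite !castmx_id -!det_mulmx AE.
pose D := \mxdiag_j mxsub (@head_ord n (width P j)) (@head_ord n (width P j)) g.
pose E :=
  \mxdiag_i mxsub (@tail_ord n (height P i)) (@tail_ord n (height P i)) g.
have detD : \det D = \prod_j \prod_(l < width P j) g (head_ord l) (head_ord l).
  by rewrite det_mxdiag; apply: eq_bigr => j _; rewrite det_head_block.
have detE : \det E =
    \prod_i \prod_(l < height P i) g (tail_ord l) (tail_ord l).
  by rewrite det_mxdiag; apply: eq_bigr => i _; rewrite det_tail_block.
rewrite /datum_weight -detD -detE mulrAC; apply: (canRL (mulfK _)).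
  by rewrite detD; apply/prodf_neq0 => j _; apply/prodf_neq0 => l _;
    apply: borel_diag_neq0.
apply: castE; rewrite mul_mxblock_mxdiag mul_mxdiag_mxblock.
by apply: eq_mxblock => i j; rewrite -corner_mulr // hornerJ corner_mull.
Qed.

(** The determinant of the datum at the generic matrix [G]. *)
Lemma datum_fun_regular : regular_fun K n.+1 (datum_fun P).
Proof.
pose R := {mpoly K[n.+1 * n.+1]}.
pose G : 'M[R]_n.+1 := \matrix_(i, j) 'X_(mxvec_index i j).
pose Q : 'M[R]_(\sum_i height P i) := castmx (erefl, sum_width P)
  (\mxblock_(i < nrows P, j < ncols P)
     mxsub (@tail_ord n (height P i)) (@head_ord n (width P j))
       (horner_mx G (map_poly (@mpolyC _ K) (entry P i j)))).
exists (\det Q) => N; rewrite -det_map_mx; congr (\det _).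
rewrite /datum_mx /Q map_castmx; congr castmx.
apply/matrixP => r y; rewrite !mxE.
have hornerG p : map_mx (meval (mxvec (val N) 0))
    (horner_mx G (map_poly (@mpolyC _ K) p)) = horner_mx (val N) p.
  rewrite map_horner_mx -map_poly_comp /=; congr horner_mx.
    by apply/matrixP => i j; rewrite !mxE mevalXU mxvecE.
  by rewrite (eq_map_poly (g := id)) ?map_poly_id // => x /=; rewrite mevalC.
by rewrite -hornerG mxE.
Qed.

Lemma datum_fun_semi_invariant : semi_invariant datum_weight (datum_fun P).
Proof.
split=> [|g gB N]; first exact: datum_fun_regular.
by rewrite /datum_fun -det_datum_mx_conj.
Qed.

End DatumSemiInvariant.

(** * The ring of semi-invariants *)

Section SemiInvariantRing.
Variables (K : fieldType) (n : nat).

Lemma semi_invariant_ring_sum (I : finType) (chi : I -> 'M[K]_n.+1 -> K)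
    (h : I -> nilcone K n.+1 -> K) :
  (forall i, borel_character (chi i)) ->
  (forall i, semi_invariant (chi i) (h i)) ->
  semi_invariant_ring K n.+1 (\sum_i h i).
Proof.
move=> chiP hP; exists #|I|, (chi \o enum_val), (h \o enum_val).
split=> [i|i|]; [exact: chiP | exact: hP |].
by rewrite (reindex _ (onW_bij _ (@enum_val_bij I))).
Qed.

Lemma semi_invariant_in_ring (chi : 'M[K]_n.+1 -> K) f :
  borel_character chi -> semi_invariant chi f -> semi_invariant_ring K n.+1 f.
Proof.
move=> chiP fP; have -> : f = \sum_(i < 1) f by rewrite big_ord1.
exact: (semi_invariant_ring_sum (chi := fun=> chi)).
Qed.

Lemma borel_character1 : borel_character (fun=> 1 : K) (n := n.+1).
Proof.
split=> [g _|g h _ _|]; [exact: oner_neq0 | by rewrite mulr1 |].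
by exists 1, 0%N => g _; rewrite rmorph1 expr0 divr1.
Qed.

Lemma borel_characterM (chi psi : 'M[K]_n.+1 -> K) :
  borel_character chi -> borel_character psi ->
  borel_character (fun g => chi g * psi g).
Proof.
move=> [chi0 chiM [p [k pE]]] [psi0 psiM [q [l qE]]].
split=> [g gB|g h gB hB|]; first by rewrite mulf_neq0 ?chi0 ?psi0.
  by rewrite chiM ?psiM // mulrACA.
exists (p * q), (k + l)%N => g gB.
by rewrite pE ?qE // rmorphM exprD invfM mulrACA.
Qed.

Lemma semi_invariantZ (chi : 'M[K]_n.+1 -> K) c f :
  semi_invariant chi f -> semi_invariant chi (c \*o f).
Proof.
move=> [[p pE] fE]; split=> [|g gB N].
  by exists (c%:MP * p) => N /=; rewrite pE rmorphM /= mevalC.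
by rewrite /= fE mulrCA.
Qed.

Lemma semi_invariantM (chi psi : 'M[K]_n.+1 -> K) f h :
  semi_invariant chi f -> semi_invariant psi h ->
  semi_invariant (fun g => chi g * psi g) (f * h).
Proof.
move=> [[p pE] fE] [[q qE] hE]; split=> [|g gB N].
  by exists (p * q) => N; rewrite mulrfctE pE qE rmorphM.
by rewrite !mulrfctE fE hE mulrACA.
Qed.

Lemma semi_invariant_ring_subalgebra :
  subalgebra (semi_invariant_ring K n.+1).
Proof.
split=> [|c f h [m1 [chi [F [chiP FP ->]]]] [m2 [psi [H [psiP HP ->]]]]
  |f h [m1 [chi [F [chiP FP ->]]]] [m2 [psi [H [psiP HP ->]]]]].
- apply: (semi_invariant_in_ring borel_character1).
  split; first by exists 1 => N; rewrite rmorph1.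
  by move=> g gB N; rewrite mul1r.
- pose chi' (i : 'I_m1 + 'I_m2) :=
    match i with inl i => chi i | inr j => psi j end.
  pose F' (i : 'I_m1 + 'I_m2) :=
    match i with inl i => c \*o F i | inr j => H j end.
  have -> : c \*o (\sum_i F i) + \sum_j H j = \sum_i F' i.
    rewrite big_sumType /=; congr (_ + _); apply/funext => N /=.
    by rewrite !fct_sumE mulr_sumr.
  apply: (semi_invariant_ring_sum (chi := chi')); case=> i //=.
  exact: semi_invariantZ.
rewrite big_distrlr pair_big /=.
apply: (semi_invariant_ring_sum
  (chi := fun ij g => chi ij.1 g * psi ij.2 g)) => ij.
  exact: borel_characterM.
exact: semi_invariantM.
Qed.

Lemma generated_subalgebra_subalgebra (T : Type) (S : set (T -> K)) :
  subalgebra (generated_subalgebra S).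
Proof.
split=> [A [[] //]|c f h Sf Sh A AP|f h Sf Sh A AP].
  by case: (AP) => -[_ lin _] _; apply: lin; [apply: Sf | apply: Sh].
by case: (AP) => -[_ _ mul] _; apply: mul; [apply: Sf | apply: Sh].
Qed.

End SemiInvariantRing.

(** A semi-invariant is fixed by shears, because characters are trivial on them,
    so [shear_invariant_span] applies to the linear space of all functions in
    the generated subalgebra. *)
Lemma semi_invariant_ring_generated (K : numFieldType) (n : nat) :
  semi_invariant_ring K n.+1 = generated_subalgebra (range (@datum_fun K n)).
Proof.
apply/seteqP; split=> f.
  case=> m [chi [h [chiP hP ->]]].
  have [gen1 genlin genM] :=
    generated_subalgebra_subalgebra (range (@datum_fun K n)).
  have gen_linear :
      linear_closed (generated_subalgebra (range (@datum_fun K n))).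
    split; last exact: genlin.
    have := genlin (-1) _ _ gen1 gen1; congr generated_subalgebra.
    by apply/funext => N; rewrite !fctE /= mulN1r addNr.
  elim/big_ind: _ => [|f1 f2 G1 G2|i _]; first by case: gen_linear.
    have := genlin 1 _ _ G1 G2; congr generated_subalgebra.
    by apply/funext => N; rewrite !fctE /= mul1r.
  have [[p pE] hE] := hP i.
  have -> : h i = fun N => p.@[mxvec (val N) 0].
    by apply/funext => N; rewrite pE.
  apply: shear_invariant_span => // [P|k l t N lt_kl nilN].
    by apply: sub_gen_smallest; exists P.
  set u := shear k l t.
  have uU : u \in unitmx by exact: shear_unit.
  have uB : u \in borel K n.+1 by exact: shear_borel.
  pose M : nilcone K n.+1 := SigSub (nilcone_conj_unit uU nilN).
  have := hE u uB M; rewrite (character_shear lt_kl t (chiP i)) mul1r !pE => <-.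
  by rewrite /= !mulmxA mulmxV // mul1mx mulmxK.
apply: smallest_sub; first exact: semi_invariant_ring_subalgebra.
move=> _ [P _ <-].
apply: semi_invariant_in_ring (datum_weight_character P) _.
exact: datum_fun_semi_invariant.
Qed.

Local Open Scope complex_scope.
Local Open Scope classical_set_scope.

(* The matrix size is n.+1, i.e. an arbitrary positive integer. *)
Theorem theorem5p2 (R : realType) (n : nat) :
  semi_invariant_ring R[i] n.+1 =
  generated_subalgebra (range (@datum_fun R[i] n)).
Proof. exact: semi_invariant_ring_generated. Qed.
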